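(* Let $\mathbb{K}$ be a field of characteristic not $2$ and let $n\geq 1$. Let $\mathcal{V}$ be a linear subspace of $M_n(\mathbb{K})$ such that every $M\in\mathcal{V}$ has at most one nonzero eigenvalue in $\mathbb{K}$ (i.e. $\#(\mathrm{Sp}_{\mathbb{K}}(M)\setminus\{0\})\leq 1$). Then $\dim\mathcal{V}\leq \binom{n}{2}+1$.
   Context: $\mathrm{Sp}_{\mathbb{K}}(M)$ denotes the set of eigenvalues of $M$ lying in $\mathbb{K}$. *)

(* Defs.v *)
From HB Require Import structures.
From mathcomp Require Import all_boot all_order all_algebra.
Set Implicit Arguments.
Unset Strict Implicit.
Unset Printing Implicit Defensive.

(* Main.v *)
(** Write rank-one matrices as f x, with x a row vector spanning the image and f a column
vector, and let matrices act on row vectors. If some nonzero x is the image line of no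
rank-one matrix of V, then compressing the stabilizer of x in V to the quotient by x loses
at most n - 1 dimensions, and induction applies. Otherwise choose f_x <> 0 with f_x x in V
for every x. A choice without "loops" (f_x does not vanish at x) and without "2-cycles"
(f_x(y) and f_y(x) both nonzero) is impossible, even off a hyperplane; 2-cycles produce the
eigenvalues 1 and -1, so there is a loop, that is a multiple f x of a projection in V.
Applying the same principle to the kernel of f shows that V contains f z for all z; these
matrices make up the whole kernel of the compression of V to the quotient by x, and the
image of that compression has no nonzero eigenvalue, since adding multiples of f x
prescribes the eigenvalue along x. Spaces without nonzero eigenvalue have dimension at most
n choose 2, by the first argument. *)

Require Import Defs.
From HB Require Import structures.
From mathcomp Require Import all_boot all_order all_algebra.
From mathcomp Require Import ring.
Import GRing.Theory.
Set Implicit Arguments.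
Unset Strict Implicit.
Local Open Scope ring_scope.

(** * Pairing of row vectors with column vectors *)

Definition pairing (K : fieldType) (n : nat) (x : 'rV[K]_n) (f : 'cV[K]_n) : K :=
  (x *m f) 0 0.

Lemma mulmx_pairing (K : fieldType) (n : nat) (x : 'rV[K]_n) (f : 'cV[K]_n) :
  x *m f = (pairing x f)%:M.
Proof. exact: mx11_scalar. Qed.

Lemma mulmx_rank1 (K : fieldType) (n p : nat) (y : 'rV[K]_n) (f : 'cV[K]_n)
    (x : 'rV[K]_p) : y *m (f *m x) = pairing y f *: x.
Proof. by rewrite mulmxA mulmx_pairing mul_scalar_mx. Qed.

Lemma pairingDl (K : fieldType) (n : nat) (x y : 'rV[K]_n) (f : 'cV[K]_n) :
  pairing (x + y) f = pairing x f + pairing y f.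
Proof. by rewrite /pairing mulmxDl mxE. Qed.

Lemma pairingNl (K : fieldType) (n : nat) (x : 'rV[K]_n) (f : 'cV[K]_n) :
  pairing (- x) f = - pairing x f.
Proof. by rewrite /pairing mulNmx mxE. Qed.

Lemma pairingZl (K : fieldType) (n : nat) (a : K) (x : 'rV[K]_n) (f : 'cV[K]_n) :
  pairing (a *: x) f = a * pairing x f.
Proof. by rewrite /pairing -scalemxAl mxE. Qed.

Lemma pairing0l (K : fieldType) (n : nat) (f : 'cV[K]_n) : pairing 0 f = 0.
Proof. by rewrite /pairing mul0mx mxE. Qed.

Lemma pairing0r (K : fieldType) (n : nat) (x : 'rV[K]_n) : pairing x 0 = 0.
Proof. by rewrite /pairing mulmx0 mxE. Qed.

Lemma pairingZr (K : fieldType) (n : nat) (a : K) (x : 'rV[K]_n) (f : 'cV[K]_n) :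
  pairing x (a *: f) = a * pairing x f.
Proof. by rewrite /pairing -scalemxAr mxE. Qed.

Lemma pairing_mul (K : fieldType) (n m : nat) (x : 'rV[K]_n) (A : 'M[K]_(n, m))
    (f : 'cV[K]_m) : pairing x (A *m f) = pairing (x *m A) f.
Proof. by rewrite /pairing mulmxA. Qed.

Lemma exists_pairing_neq0 (K : fieldType) (n : nat) (f : 'cV[K]_n) :
  f != 0 -> exists x : 'rV[K]_n, pairing x f != 0.
Proof.
case/cV0Pn=> i fi; exists (delta_mx 0 i).
by rewrite /pairing -rowE mxE.
Qed.

Lemma span_pairing0 (K : fieldType) (n : nat) (s : seq 'rV[K]_n) (f : 'cV[K]_n) :
  (forall y, y \in s -> pairing y f = 0) ->
  forall x, x \in <<s>>%VS -> pairing x f = 0.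
Proof.
move=> sf x; have /subvP sub : (<<s>> <= lker (linfun (mulmxr f : 'rV[K]_n -> 'M[K]_1)))%VS.
  apply/span_subvP => y ys; rewrite memv_ker lfunE /= mulmx_pairing sf //.
  by rewrite raddf0.
by move/sub; rewrite memv_ker lfunE /= => /eqP xf; rewrite /pairing xf mxE.
Qed.

(** * Chains and fields of linear functionals *)

(* With the most recent vector at the head: each [b x] kills [x] and the older vectors, but
   none of the newer ones; hence [s] is free. *)
Fixpoint chain (K : fieldType) (n : nat) (b : 'rV[K]_n -> 'cV[K]_n) (g : 'cV[K]_n)
    (s : seq 'rV[K]_n) : Prop :=
  if s is x :: s' then
    [/\ pairing x g != 0, forall y, y \in s -> pairing y (b x) = 0,
        forall y, y \in s' -> pairing x (b y) != 0 & chain b g s']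
  else True.

(** The functional of the head of the tail kills the whole tail but not the new vector [x]; when the
    tail is empty, [g] shows that [x] is nonzero. *)
Lemma chain_free (K : fieldType) (n : nat) (b : 'rV[K]_n -> 'cV[K]_n) (g : 'cV[K]_n)
    (s : seq 'rV[K]_n) : chain b g s -> free s.
Proof.
elim: s => [|x s IHs]; first by rewrite nil_free.
move=> /= [xg _ xb cs]; rewrite free_cons IHs // andbT.
case: s cs xb {IHs} => [_ _|y s /= [_ yb _ _] xb].
  by rewrite span_nil memv0; apply: contraNneq xg => ->; rewrite pairing0l.
apply/negP => /(span_pairing0 yb) /eqP; apply/negP.
by apply: xb; rewrite mem_head.
Qed.

Lemma adjust_pairing (K : fieldType) (n : nat) (x y0 : 'rV[K]_n) (g : 'cV[K]_n) :
  pairing x g != 0 ->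
  exists y : 'rV[K]_n,
    pairing y g != 0 /\ forall h, pairing x h = 0 -> pairing y h = pairing y0 h.
Proof.
move=> xg; have [y0g|y0g] := eqVneq (pairing y0 g) 0; last by exists y0.
exists (y0 + x); rewrite pairingDl y0g add0r; split=> // h xh.
by rewrite pairingDl xh addr0.
Qed.

(* Adding multiples of the vectors of the chain, newest first, corrects the values of [b z],
   from the newest [z] to the oldest and finally of [g], without disturbing earlier corrections. *)
Lemma chain_adjust (K : fieldType) (n : nat) (b : 'rV[K]_n -> 'cV[K]_n)
    (g : 'cV[K]_n) (s : seq 'rV[K]_n) (x y0 : 'rV[K]_n) :
  chain b g (x :: s) ->
  exists y, [/\ pairing y g != 0, forall z, z \in s -> pairing y (b z) != 0 &
    forall h, (forall z, z \in x :: s -> pairing z h = 0) ->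
      pairing y h = pairing y0 h].
Proof.
elim: s x y0 => [|z s IHs] x y0 /= [xg _ xb cs].
  have [y [yg yh]] := adjust_pairing y0 xg; exists y; split=> // h sh.
  by apply: yh; apply: sh; rewrite mem_head.
have [y1 [y1z y1h]] := adjust_pairing y0 (xb z (mem_head _ _)).
have [y [yg ys yh]] := IHs z y1 cs; exists y; split=> // [w|h sh].
  rewrite inE => /predU1P[->|]; last exact: ys.
  by rewrite yh //; case: cs.
rewrite yh => [|w ws]; first by apply: y1h; apply: sh; rewrite mem_head.
by apply: sh; rewrite inE ws orbT.
Qed.

(** Otherwise chains grow forever: a vector not killed by the newest functional is adjusted to be
    killed neither by [g] nor by any functional of the chain, and the absence of loops and 2-cycles
    lets it head a longer chain. Length [n.+1] contradicts freeness. *)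
Lemma functional_field_zero (K : fieldType) (n : nat) (b : 'rV[K]_n -> 'cV[K]_n)
    (g : 'cV[K]_n) :
  g != 0 ->
  (forall x, pairing x g != 0 -> pairing x (b x) = 0) ->
  (forall x y, pairing x g != 0 -> pairing y g != 0 ->
     pairing y (b x) != 0 -> pairing x (b y) = 0) ->
  (forall x, pairing x g != 0 -> b x != 0) -> False.
Proof.
move=> g0 bxx bxy b0.
have chains k : exists s : seq 'rV[K]_n, size s = k /\ chain b g s.
  elim: k => [|k [s [<- cs]]]; first by exists [::].
  case: s cs => [_|x s cs].
    have [x xg] := exists_pairing_neq0 g0; exists [:: x]; split=> //=.
    by split=> // y; rewrite inE => /eqP ->; apply: bxx.
  have [xg xb _ _] := cs.
  have [y0 y0b] := exists_pairing_neq0 (b0 x xg).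
  have [y [yg ys yh]] := chain_adjust y0 cs.
  have sg z : z \in x :: s -> pairing z g != 0.
    elim: (x :: s) cs => //= w t IHt [wg _ _ ct].
    by rewrite inE => /predU1P[->|/IHt->].
  have yb z : z \in x :: s -> pairing y (b z) != 0.
    by rewrite inE => /predU1P[->|/ys//]; rewrite yh.
  exists [:: y, x & s]; split=> //; split=> // z.
  rewrite inE => /predU1P[->|zs]; first exact: bxx.
  by apply: bxy => //; [exact: sg | exact: yb].
have [s [sz /chain_free]] := chains n.+1.
rewrite /free sz => /eqP dims.
by have := dimvS (subvf <<s>>%VS); rewrite dims dimvf /dim /= mul1n ltnn.
Qed.

(** * Quotient by a vector and compression *)

(** The projection [1%:M - f *m x] has a rank factorization [B *m S]: the rows of [S] form a basis
    of the kernel of [f], and [B] gives coordinates modulo [x]. *)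
Lemma quotient_decomposition (K : fieldType) (n : nat) (x : 'rV[K]_n) (f : 'cV[K]_n) :
  pairing x f = 1 ->
  exists m : nat, [/\ (m.+1 = n)%N &
    exists (S : 'M[K]_(m, n)) (B : 'M[K]_(n, m)),
      [/\ S *m B = 1%:M, x *m B = 0, S *m f = 0 & f *m x + B *m S = 1%:M]].
Proof.
move=> xf; pose Q : 'M[K]_n := 1%:M - f *m x.
have xQ : x *m Q = 0 by rewrite mulmxBr mulmx1 mulmx_rank1 xf scale1r subrr.
have Qf : Q *m f = 0.
  by rewrite mulmxBl mul1mx -mulmxA mulmx_pairing xf mulmx1 subrr.
have x0 : x != 0 by apply/eqP => x0; move: xf; rewrite x0 pairing0l => /esym/eqP; rewrite oner_eq0.
have QBS := mulmx_base Q.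
exists (\rank Q); split.
  have le1 : (\rank Q < n)%N.
    have := mulmx0_rank_max xQ.
    by rewrite rank_rV x0 add1n.
  apply/eqP; rewrite eqn_leq le1 /=.
  have := mxrank_add (f *m x) Q; rewrite addrC subrK mxrank1.
  move=> /leq_trans; apply; rewrite -[X in (_ <= X)%N]add1n leq_add2r.
  exact: leq_trans (mxrankM_maxr _ _) (rank_leq_row _).
exists (row_base Q), (col_base Q).
(* Cancelling [B] on the left and [S] on the right reduces the identities to ones about [Q]. *)
have injS p := @row_free_inj K p _ _ _ (row_base_free Q).
have injB p := @row_full_inj K _ _ p _ (col_base_full Q).
split.
- apply: injB; apply: injS => /=.
  rewrite mulmx1 QBS -mulmxA -(mulmxA (row_base Q)) QBS mulmxA QBS.
  by rewrite {1}/Q mulmxBl mul1mx -mulmxA xQ mulmx0 subr0.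
- by apply: injS; rewrite /= mul0mx -mulmxA QBS.
- by apply: injB; rewrite /= mulmx0 mulmxA QBS.
- by rewrite QBS addrC subrK.
Qed.

Definition rank1_coeffs (K : fieldType) (n : nat) (V : {vspace 'M[K]_n}) (x : 'rV[K]_n) :
    {vspace 'cV[K]_n} :=
  (linfun (mulmxr x : 'cV[K]_n -> 'M[K]_n) @^-1: V)%VS.

Lemma mem_rank1_coeffs (K : fieldType) (n : nat) (V : {vspace 'M[K]_n}) (x : 'rV[K]_n)
    (f : 'cV[K]_n) : (f \in rank1_coeffs V x) = (f *m x \in V).
Proof. by rewrite -memv_preim lfunE. Qed.

Definition compression (K : fieldType) (m n : nat) (S : 'M[K]_(m, n)) (B : 'M[K]_(n, m)) :
    'Hom('M[K]_n, 'M[K]_m) :=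
  linfun (mulmxr B \o mulmx S : 'M[K]_n -> 'M[K]_m).

Lemma compressionE (K : fieldType) (m n : nat) (S : 'M[K]_(m, n)) (B : 'M[K]_(n, m))
    (M : 'M[K]_n) : compression S B M = S *m M *m B.
Proof. by rewrite lfunE. Qed.

(** In block form [M] is triangular with [c] in the corner of [x]. For [a != c], the lift [u *m S]
    of an eigenvector becomes one of [M] after adding a multiple of [x]. *)
Lemma eigenvalue_compression (K : fieldType) (m n : nat) (x : 'rV[K]_n) (f : 'cV[K]_n)
    (S : 'M[K]_(m, n)) (B : 'M[K]_(n, m)) (M : 'M[K]_n) (c a : K) :
  S *m B = 1%:M -> x *m B = 0 -> f *m x + B *m S = 1%:M -> pairing x f = 1 ->
  x *m M = c *: x -> eigenvalue (S *m M *m B) a -> eigenvalue M a.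
Proof.
move=> SB xB fxBS xf xM /eigenvalueP[u uM u0].
have x0 : x != 0.
  by apply: contra_eq_neq xf => ->; rewrite pairing0l eq_sym oner_eq0.
have [<-|ac] := eqVneq c a; first by apply/eigenvalueP; exists x.
have uSM : u *m S *m M = pairing (u *m S *m M) f *: x + a *: (u *m S).
  rewrite -[LHS]mulmx1 -fxBS mulmxDr mulmx_rank1; congr (_ + _).
  by rewrite scalemxAl -uM !mulmxA.
set d := pairing _ _ in uSM; have ac0 : a - c != 0 by rewrite subr_eq0 eq_sym.
apply/eigenvalueP; exists (u *m S + (d / (a - c)) *: x).
  rewrite mulmxDl uSM -scalemxAl xM scalerDr !scalerA addrAC -scalerDl addrC.
  by congr (_ + _ *: _); field.
apply: contraNneq u0 => /(congr1 (mulmx^~ B)).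
by rewrite mul0mx mulmxDl -scalemxAl xB scaler0 addr0 -mulmxA SB mulmx1 => ->.
Qed.

(** Stabilizing the line of [x], that is [x *m M *m B = 0], costs at most [m] dimensions. A
    stabilizing [M] killed by the compression equals [M *m f *m x], hence vanishes. *)
Lemma dimv_compression (K : fieldType) (m n : nat) (x : 'rV[K]_n) (f : 'cV[K]_n)
    (S : 'M[K]_(m, n)) (B : 'M[K]_(n, m)) (V : {vspace 'M[K]_n}) :
  f *m x + B *m S = 1%:M -> rank1_coeffs V x = 0%VS ->
  (\dim V <= m + \dim (compression S B @:
    (V :&: lker (linfun (mulmxr B \o mulmx x : 'M[K]_n -> 'rV[K]_m)))))%N.
Proof.
move=> fxBS Vx; set r := linfun _.
rewrite -(limg_ker_dim r V) addnC leq_add //.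
  by apply: leq_trans (dimvS (subvf _)) _; rewrite dimvf /dim /= mul1n.
rewrite limg_dim_eq //; apply/eqP; rewrite -subv0; apply/subvP => M.
rewrite !memv_cap !memv_ker compressionE lfunE /= => /andP[/andP[MV /eqP xMB] /eqP SMB].
have MB : M *m B = 0.
  rewrite -[LHS]mul1mx -fxBS mulmxDl -!mulmxA [x *m _]mulmxA xMB.
  by rewrite [S *m _]mulmxA SMB !mulmx0 addr0.
have M1 : M = M *m f *m x.
  by rewrite -[LHS]mulmx1 -fxBS mulmxDr !mulmxA MB mul0mx addr0.
have : M *m f \in rank1_coeffs V x by rewrite mem_rank1_coeffs -M1.
by rewrite Vx !memv0 => /eqP Mf; rewrite M1 Mf mul0mx.
Qed.

(** * Eigenvalues produced by pairs of rank-one matrices *)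

(** A suitable combination swaps [z] and [w]. *)
Lemma eigenvalue_two_cycle (K : fieldType) (n : nat) (V : {vspace 'M[K]_n})
    (z w : 'rV[K]_n) (f h : 'cV[K]_n) :
  f *m z \in V -> h *m w \in V -> pairing z f = 0 -> pairing w h = 0 ->
  pairing z h != 0 -> pairing w f != 0 ->
  exists2 M, M \in V & eigenvalue M 1 /\ eigenvalue M (-1).
Proof.
move=> fV hV zf wh zh wf.
exists ((pairing w f)^-1 *: (f *m z) + (pairing z h)^-1 *: (h *m w)).
  by rewrite rpredD // rpredZ.
set M := _ + _.
have zM : z *m M = w.
  by rewrite mulmxDr -!scalemxAr !mulmx_rank1 zf scale0r scaler0 add0r scalerA mulVf ?scale1r.
have wM : w *m M = z.
  by rewrite mulmxDr -!scalemxAr !mulmx_rank1 wh scale0r scaler0 addr0 scalerA mulVf ?scale1r.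
split; apply/eigenvalueP; [exists (z + w)|exists (z - w)].
- by rewrite mulmxDl zM wM scale1r addrC.
- by apply: contraNneq wf => /(congr1 (fun v => pairing v f)); rewrite pairingDl zf add0r pairing0l => ->.
- by rewrite mulmxBl zM wM scaleN1r opprB.
- apply: contraNneq wf => /(congr1 (fun v => pairing v f)).
  by rewrite pairingDl pairingNl zf add0r pairing0l => /eqP; rewrite oppr_eq0.
Qed.

Lemma eigenvalue_rank1 (K : fieldType) (n : nat) (f : 'cV[K]_n) (x : 'rV[K]_n) :
  pairing x f != 0 -> eigenvalue (f *m x) (pairing x f).
Proof.
move=> xf; apply/eigenvalueP; exists x; first by rewrite mulmx_rank1.
by apply: contraNneq xf => ->; rewrite pairing0l.
Qed.

(** A suitable combination acts on the span of [x] and [z] triangularly, with diagonal [-1], [1]. *)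
Lemma eigenvalue_projection_pair (K : fieldType) (n : nat) (V : {vspace 'M[K]_n})
    (x z : 'rV[K]_n) (f h : 'cV[K]_n) :
  2%:R != 0 :> K -> f *m x \in V -> h *m z \in V -> pairing x f = 1 ->
  pairing z f = 0 -> pairing z h != 0 ->
  exists2 M, M \in V & eigenvalue M 1 /\ eigenvalue M (-1).
Proof.
move=> two fV hV xf zf zh.
exists (- (f *m x) + (pairing z h)^-1 *: (h *m z)).
  by rewrite rpredD ?rpredN ?rpredZ.
set M := _ + _; pose t := pairing x h / pairing z h.
have xM : x *m M = - x + t *: z.
  by rewrite mulmxDr mulmxN -!scalemxAr !mulmx_rank1 xf scale1r scalerA mulrC.
have zM : z *m M = z.
  by rewrite mulmxDr mulmxN -!scalemxAr !mulmx_rank1 zf scale0r oppr0 add0r scalerA mulVf ?scale1r.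
split; apply/eigenvalueP.
  exists z; first by rewrite zM scale1r.
  by apply: contraNneq zh => ->; rewrite pairing0l.
exists (x - (t / 2%:R) *: z).
  rewrite mulmxBl -scalemxAl xM zM scaleN1r opprB [RHS]addrC -addrA -scalerBl.
  by congr (_ + _ *: _); field.
apply: contra_eq_neq xf => /eqP; rewrite subr_eq0 => /eqP ->.
by rewrite pairingZl zf mulr0 eq_sym oner_eq0.
Qed.

(** * Spaces without nonzero eigenvalue *)

Definition trivial_spectrum (K : fieldType) (n : nat) (V : {vspace 'M[K]_n}) : Prop :=
  forall M, M \in V -> forall a, eigenvalue M a -> a = 0.

Definition sole_nonzero_eigenvalue (K : fieldType) (n : nat) (V : {vspace 'M[K]_n}) : Prop :=
  forall M, M \in V -> forall a b, eigenvalue M a -> eigenvalue M b ->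
    a != 0 -> b != 0 -> a = b.

Lemma stable_compression_eigenvalue (K : fieldType) (m n : nat) (x : 'rV[K]_n)
    (f : 'cV[K]_n) (S : 'M[K]_(m, n)) (B : 'M[K]_(n, m)) (V : {vspace 'M[K]_n}) N :
  S *m B = 1%:M -> x *m B = 0 -> f *m x + B *m S = 1%:M -> pairing x f = 1 ->
  N \in (compression S B @:
    (V :&: lker (linfun (mulmxr B \o mulmx x : 'M[K]_n -> 'rV[K]_m))))%VS ->
  exists2 M, M \in V & forall a, eigenvalue N a -> eigenvalue M a.
Proof.
move=> SB xB fxBS xf /memv_imgP[M]; rewrite memv_cap memv_ker lfunE /=.
move=> /andP[MV /eqP xMB] ->; exists M => // a; rewrite compressionE.
apply: (eigenvalue_compression (c := pairing (x *m M) f) SB xB fxBS xf).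
by rewrite -[LHS]mulmx1 -fxBS mulmxDr [_ *m (B *m S)]mulmxA xMB mul0mx addr0 mulmx_rank1.
Qed.

Lemma normalize_pairing (K : fieldType) (n : nat) (x : 'rV[K]_n) (g : 'cV[K]_n) :
  pairing x g != 0 -> pairing x ((pairing x g)^-1 *: g) = 1.
Proof. by move=> xg; rewrite pairingZr mulVf. Qed.

Theorem dimv_trivial_spectrum (K : fieldType) (n : nat) (V : {vspace 'M[K]_n}) :
  trivial_spectrum V -> (\dim V <= 'C(n, 2))%N.
Proof.
elim/ltn_ind: n V => n IHn V trV; rewrite leqNgt; apply/negP => dimV.
have [n0|n_gt0] := posnP n.
  have := leq_trans dimV (dimvS (subvf V)).
  by rewrite dimvf /dim /= n0.
have g0 : const_mx 1 != 0 :> 'cV[K]_n.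
  by apply/cV0Pn; exists (Ordinal n_gt0); rewrite mxE oner_eq0.
have vpickV x : vpick (rank1_coeffs V x) *m x \in V.
  by rewrite -mem_rank1_coeffs memv_pick.
have loop x : pairing x (vpick (rank1_coeffs V x)) = 0.
  apply/eqP/negPn/negP => xf; move: (xf) => /eqP; apply.
  by apply: trV (vpickV x) _ (eigenvalue_rank1 xf).
apply: (functional_field_zero (b := fun x => vpick (rank1_coeffs V x)) g0) => //.
  move=> x y _ _ yx; apply/eqP/negPn/negP => xy.
  have [M MV [M1 _]] := eigenvalue_two_cycle (vpickV x) (vpickV y) (loop x) (loop y) xy yx.
  by have /eqP := trV M MV 1 M1; rewrite oner_eq0.
(* If the coefficients at [x] vanish, induction bounds the compressed stabilizer by ['C(m, 2)], and
   the [m] lost dimensions give exactly ['C(n, 2)]. *)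
move=> x /normalize_pairing; set f := _ *: _ => xf; rewrite vpick0; apply/negP => /eqP Vx.
have [m [mn [S [B [SB xB Sf fxBS]]]]] := quotient_decomposition xf.
have := dimv_compression fxBS Vx; apply/negP; rewrite -ltnNge.
apply: leq_trans dimV; have -> : 'C(n, 2) = ('C(m, 2) + m)%N by rewrite -mn binS bin1.
rewrite addnC ltnS leq_add2r; apply: IHn; first by rewrite -mn.
move=> N /(stable_compression_eigenvalue SB xB fxBS xf)[M MV NM] a /NM.
exact: trV.
Qed.

(** * Spaces containing a rank-one projection *)

(* The projection f x lets the eigenvalue along x be prescribed freely. *)
Lemma compression_trivial_spectrum (K : fieldType) (m n : nat) (x : 'rV[K]_n)
    (f : 'cV[K]_n) (S : 'M[K]_(m, n)) (B : 'M[K]_(n, m)) (V : {vspace 'M[K]_n}) :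
  2%:R != 0 :> K -> sole_nonzero_eigenvalue V ->
  S *m B = 1%:M -> x *m B = 0 -> S *m f = 0 -> f *m x + B *m S = 1%:M -> pairing x f = 1 ->
  (forall z, f *m z \in V) -> trivial_spectrum (compression S B @: V)%VS.
Proof.
move=> two seV SB xB Sf fxBS xf fV _ /memv_imgP[M MV ->] a.
rewrite compressionE => Na; apply/eqP/negPn/negP => a0.
(* Since [S *m f = 0], the compression is unchanged, while the eigenvalue along [x] becomes [- a],
   distinct from [a]. *)
pose M' := M - f *m (x *m M + a *: x).
have M'V : M' \in V by rewrite rpredB.
have SM' : S *m M' = S *m M by rewrite mulmxBr mulmxA Sf mul0mx subr0.
have xM' : x *m M' = - a *: x.
  by rewrite mulmxBr mulmx_rank1 xf scale1r opprD addrA subrr sub0r scaleNr.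
have M'a : eigenvalue M' a.
  by apply: (eigenvalue_compression SB xB fxBS xf xM'); rewrite SM'.
have M'Na : eigenvalue M' (- a).
  apply/eigenvalueP; exists x => //.
  by apply: contra_eq_neq xf => ->; rewrite pairing0l eq_sym oner_eq0.
move: (seV M' M'V _ _ M'a M'Na a0); rewrite oppr_eq0 => /(_ a0)/eqP.
by rewrite -subr_eq0 opprK -mulr2n -mulr_natl mulf_eq0 (negPf two) (negPf a0).
Qed.

Lemma sole_nonzero_eigenvalue_pm1 (K : fieldType) (n : nat) (V : {vspace 'M[K]_n}) :
  2%:R != 0 :> K -> sole_nonzero_eigenvalue V ->
  ~ exists2 M, M \in V & eigenvalue M 1 /\ eigenvalue M (-1).
Proof.
move=> two seV [M MV [M1 MN1]]; move: (seV M MV _ _ M1 MN1).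
rewrite oppr_eq0 oner_eq0 => /(_ isT isT)/eqP.
by rewrite -subr_eq0 opprK -[_ + _]/(2%:R) (negPf two).
Qed.

(** The functional is a coordinate of [z - projv T z] that is nonzero at [z0]. *)
Lemma separating_functional (K : fieldType) (n : nat) (T : {vspace 'rV[K]_n}) z0 :
  z0 \notin T ->
  exists2 g : 'cV[K]_n, pairing z0 g != 0 & forall z, z \in T -> pairing z g = 0.
Proof.
move=> z0T; pose h : 'End('rV[K]_n) := (\1 - projv T)%VF.
have hE z : h z = z - projv T z by rewrite add_lfunE id_lfunE opp_lfunE.
have pairE i z : pairing z (col i (lin1_mx h)) = (h z) 0 i.
  by rewrite /pairing colE mulmxA -colE mxE mul_rV_lin1.
have : h z0 != 0.
  by apply: contraNneq z0T; rewrite hE => /eqP; rewrite subr_eq0 => /eqP ->; apply: memv_proj.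
case/rV0Pn=> i hi; exists (col i (lin1_mx h)); first by rewrite pairE.
by move=> z zT; rewrite pairE hE projv_id // subrr mxE.
Qed.

Lemma mem_rank1_of_projection (K : fieldType) (n : nat) (V : {vspace 'M[K]_n})
    (x : 'rV[K]_n) (f : 'cV[K]_n) :
  2%:R != 0 :> K -> sole_nonzero_eigenvalue V ->
  (forall z, z != 0 -> rank1_coeffs V z != 0%VS) ->
  pairing x f = 1 -> f *m x \in V -> forall z, f *m z \in V.
Proof.
move=> two seV Vz xf fxV.
have no_pm1 := sole_nonzero_eigenvalue_pm1 two seV.
pose T : {vspace 'rV[K]_n} := (linfun (mulmx f : 'rV[K]_n -> 'M[K]_n) @^-1: V)%VS.
have memT z : (z \in T) = (f *m z \in V) by rewrite -memv_preim lfunE.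
suff Tfull : T = fullv by move=> z; rewrite -memT Tfull memvf.
apply/eqP; rewrite eqEsubv subvf /=; apply/negPn/negP => /subvPn[z0 _ z0T].
have [g z0g Tg] := separating_functional z0T.
have xg : pairing x g = 0 by apply: Tg; rewrite memT.
have g0 : g != 0 by apply: contraNneq z0g => ->; rewrite pairing0r.
(* Precomposing with the projection [Q] onto the kernel of [f] allows a functional field on the
   whole space instead of on that kernel. *)
pose Q : 'M[K]_n := 1%:M - f *m x.
have QE z : z *m Q = z - pairing z f *: x by rewrite mulmxBr mulmx1 mulmx_rank1.
have Qf z : pairing (z *m Q) f = 0.
  by rewrite QE pairingDl pairingNl pairingZl xf mulr1 subrr.
have Qg z : pairing (z *m Q) g = pairing z g.
  by rewrite QE pairingDl pairingNl pairingZl xg mulr0 subr0.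
pose h z := vpick (rank1_coeffs V (z *m Q)).
have hV z : h z *m (z *m Q) \in V by rewrite -mem_rank1_coeffs memv_pick.
have loop z : pairing (z *m Q) (h z) = 0.
  apply/eqP/negPn/negP => zh; apply: no_pm1.
  exact: eigenvalue_projection_pair two fxV (hV z) xf (Qf z) zh.
apply: (functional_field_zero (b := fun z => Q *m h z) g0) => /=.
- by move=> z _; rewrite pairing_mul loop.
- move=> z w _ _; rewrite !pairing_mul => wz; apply/eqP/negPn/negP => zw.
  exact/no_pm1/(eigenvalue_two_cycle (hV z) (hV w) (loop z) (loop w) zw wz).
move=> z zg; apply/eqP => Qh.
(* A functional killed by [Q] is a multiple of [f]; this puts [z *m Q] in [T], where [g]
   vanishes. *)
have hf : h z = pairing x (h z) *: f.
  apply/eqP; rewrite -subr_eq0 -mul_mx_scalar -mulmx_pairing mulmxA.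
  by rewrite -[X in X - _]mul1mx -mulmxBl Qh.
have h0 : h z != 0.
  rewrite vpick0; apply: Vz; apply: contraNneq zg => zQ.
  by rewrite -Qg zQ pairing0l.
have xh : pairing x (h z) != 0 by apply: contraNneq h0 => xh; rewrite hf xh scale0r.
have zQT : z *m Q \in T.
  rewrite memT.
  have -> : f = (pairing x (h z))^-1 *: h z by rewrite {2}hf scalerA mulVf ?scale1r.
  by rewrite -scalemxAl rpredZ.
by move: zg; rewrite -Qg Tg ?eqxx.
Qed.

(** Rank-nullity for the compression: the image has dimension at most ['C(m, 2)], and the kernel
    consists of matrices [f *m z], so has dimension at most [n = m.+1]. *)
Lemma dimv_of_projection (K : fieldType) (n : nat) (V : {vspace 'M[K]_n})
    (x : 'rV[K]_n) (f : 'cV[K]_n) :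
  2%:R != 0 :> K -> sole_nonzero_eigenvalue V ->
  (forall z, z != 0 -> rank1_coeffs V z != 0%VS) ->
  pairing x f = 1 -> f *m x \in V -> (\dim V <= 'C(n, 2) + 1)%N.
Proof.
move=> two seV Vz xf fxV.
have no_pm1 := sole_nonzero_eigenvalue_pm1 two seV.
have fV := mem_rank1_of_projection two seV Vz xf fxV.
have [m [mn [S [B [SB xB Sf fxBS]]]]] := quotient_decomposition xf.
have binE : 'C(n, 2) = ('C(m, 2) + m)%N by rewrite -mn binS bin1.
rewrite -(limg_ker_dim (compression S B) V) binE -addnA addn1 mn addnC leq_add //.
  exact/dimv_trivial_spectrum/(compression_trivial_spectrum two seV SB xB Sf fxBS xf fV).
set F : 'Hom('rV[K]_n, 'M[K]_n) := linfun (mulmx f).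
suff : (V :&: lker (compression S B) <= limg F)%VS.
  move=> /dimvS/leq_trans; apply.
  have := limg_ker_dim F fullv; rewrite dimvf /dim /= mul1n => dimF.
  by rewrite -[X in (_ <= X)%N]dimF leq_addl.
apply/subvP => M; rewrite memv_cap memv_ker compressionE => /andP[MV /eqP SMB].
pose h := B *m (S *m M *m f).
have hM : h *m x = M - f *m (x *m M).
  have SM : S *m M = S *m M *m f *m x.
    by rewrite -[LHS]mulmx1 -fxBS mulmxDr !mulmxA SMB mul0mx addr0.
  by rewrite -mulmxA -SM -[X in X - _]mul1mx -fxBS mulmxDl !mulmxA addrAC subrr add0r.
have hV : h *m x \in V by rewrite hM rpredB.
have xh : pairing x h = 0 by rewrite pairing_mul xB pairing0l.
suff h0 : h = 0.
  apply/memv_imgP; exists (x *m M); first exact: memvf.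
  by rewrite lfunE /=; apply/eqP; rewrite -subr_eq0 -hM h0 mul0mx.
apply/eqP/negPn/negP => /exists_pairing_neq0[w wh].
(* Moved into the kernel of [f], [w] still pairs nontrivially with [h], so [f *m w'] and [h *m x]
   form a 2-cycle. *)
pose w' := w - pairing w f *: x.
have w'f : pairing w' f = 0 by rewrite pairingDl pairingNl pairingZl xf mulr1 subrr.
have w'h : pairing w' h != 0 by rewrite pairingDl pairingNl pairingZl xh mulr0 subr0.
apply: no_pm1; apply: eigenvalue_two_cycle (fV w') hV w'f xh w'h _.
by rewrite xf oner_eq0.
Qed.

Unset Implicit Arguments.

Theorem mainTheorem2 (K : fieldType) (hK : (2 \notin [pchar K])%N) (n : nat)
  (hn : (1 <= n)%N) (V : {vspace 'M[K]_n}) :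
  (forall M : 'M[K]_n, M \in V ->
     forall a b : K, eigenvalue M a -> eigenvalue M b -> a != 0 -> b != 0 -> a = b) ->
  (\dim V <= 'C(n, 2) + 1)%N.
Proof.
have two : 2%:R != 0 :> K by move: hK; rewrite inE.
elim/ltn_ind: n hn V => n IHn n_gt0 V seV; rewrite leqNgt; apply/negP => dimV.
have no_pm1 := sole_nonzero_eigenvalue_pm1 two seV.
have not_adapted x : x != 0 -> rank1_coeffs V x != 0%VS.
  case/rV0Pn=> i xi; apply/negP => /eqP Vx.
  have xg : pairing x (delta_mx i 0) != 0 by rewrite /pairing -colE mxE.
  move: (normalize_pairing xg); set f := _ *: _ => xf.
  have [m [mn [S [B [SB xB Sf fxBS]]]]] := quotient_decomposition xf.
  have := dimv_compression fxBS Vx; apply/negP; rewrite -ltnNge.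
  apply: leq_trans dimV; have -> : 'C(n, 2) = ('C(m, 2) + m)%N by rewrite -mn binS bin1.
  rewrite [X in (X + 1)%N]addnC -addnA ltnS leq_add2l.
  (* The induction hypothesis starts at size 1, so the zero quotient is treated apart. *)
  have [m0|m_gt0] := posnP m.
    by apply: leq_trans (dimvS (subvf _)) _; rewrite dimvf /dim /= m0.
  apply: IHn => //; first by rewrite -mn.
  move=> N /(stable_compression_eigenvalue SB xB fxBS xf)[M MV NM] a b /NM Ma /NM Mb.
  exact: seV Ma Mb.
(* A loop rescales to a projection in [V], which already forces the bound. *)
have nilp x f : f *m x \in V -> pairing x f = 0.
  move=> fV; apply/eqP/negPn/negP => xf.
  have := dimv_of_projection two seV not_adapted (normalize_pairing xf).
  rewrite -scalemxAl rpredZ // => /(_ isT).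
  by rewrite leqNgt dimV.
have g0 : const_mx 1 != 0 :> 'cV[K]_n.
  by apply/cV0Pn; exists (Ordinal n_gt0); rewrite mxE oner_eq0.
have vpickV x : vpick (rank1_coeffs V x) *m x \in V.
  by rewrite -mem_rank1_coeffs memv_pick.
apply: (functional_field_zero (b := fun x => vpick (rank1_coeffs V x)) g0).
- by move=> x _; apply: nilp.
- move=> x y _ _ yx; apply/eqP/negPn/negP => xy.
  exact/no_pm1/(eigenvalue_two_cycle (vpickV x) (vpickV y) (nilp _ _ (vpickV x)) (nilp _ _ (vpickV y)) xy yx).
move=> x xg; rewrite vpick0; apply: not_adapted.
by apply: contraNneq xg => ->; rewrite pairing0l.
Qed.
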